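(* For all $\epsilon>0$ and for all sufficiently large $n>n(\epsilon)$, there exists an $n$-vertex graph $G$ with slope parameter $$\mathsf{sl}(G)\geq\frac{n^2}{(4+\epsilon)\log n},$$ where $\log$ denotes the binary logarithm.
   Context: Graphs are undirected, finite and simple. For a set $P\subseteq\mathbb{R}^2$ of points in the plane and a set $S\subset\mathbb{R}\cup\{\infty\}$ of slopes, $G(P,S)$ is the graph with vertex set $P$ in which two distinct points $v,w\in P$ are adjacent if and only if the slope of the line $\overline{vw}$ is in $S$. The slope parameter $\mathsf{sl}(G)$ of a graph $G$ is the minimum integer $k$ such that $G\cong G(P,S)$ for some point set $P$ and slope set $S$ with $|S|=k$. *)

(* Defs.v *)
From HB Require Import structures.
From mathcomp Require Import all_boot all_order all_algebra.
From mathcomp Require Import finmap.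
From mathcomp Require Import boolp reals exp.

Set Implicit Arguments.
Unset Strict Implicit.
Unset Printing Implicit Defensive.

Import Order.TTheory GRing.Theory Num.Theory.

Local Open Scope ring_scope.
Local Open Scope fset_scope.

Record sgraph := SGraph {
  vertex :> finType;
  adj : rel vertex;
  adj_sym : symmetric adj;
  adj_irr : irreflexive adj }.

Definition graph_iso (G H : sgraph) : Prop :=
  exists2 f : G -> H, bijective f & forall v w, adj (f v) (f w) = adj v w.

(* Slopes live in R ∪ {∞}, encoded as [option R] with [None] for the slope
   of a vertical line. *)
Definition slope (R : realType) (v w : R * R) : option R :=
  if v.1 == w.1 then None else Some ((w.2 - v.2) / (w.1 - v.1)).

Lemma slopeC (R : realType) (v w : R * R) : slope v w = slope w v.
Proof.
rewrite /slope [w.1 == _]eq_sym; case: eqP => // _; congr Some.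
by rewrite -[w.2 - v.2]opprB -[w.1 - v.1]opprB invrN mulrNN.
Qed.

Section SlopeGraph.
Variables (R : realType) (P : {fset R * R}) (S : {fset option R}).

Definition slope_adj : rel P :=
  fun v w => (v != w) && (slope (val v) (val w) \in S).

Lemma slope_adj_sym : symmetric slope_adj.
Proof. by move=> v w; rewrite /slope_adj eq_sym slopeC. Qed.

Lemma slope_adj_irr : irreflexive slope_adj.
Proof. by move=> v; rewrite /slope_adj eqxx. Qed.

Definition slope_graph : sgraph := SGraph slope_adj_sym slope_adj_irr.

End SlopeGraph.

Definition slope_representable (R : realType) (G : sgraph) (k : nat) : Prop :=
  exists (P : {fset R * R}) (S : {fset option R}),
    #|` S| = k /\ graph_iso G (slope_graph P S).


Section Existence.
Variables (R : realType) (G : sgraph).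

Lemma pow2D_inj (a b c d : nat) : (a < b)%N -> (c < d)%N ->
  (2 ^ a + 2 ^ b = 2 ^ c + 2 ^ d)%N -> a = c /\ b = d.
Proof.
have top x y : (x < y)%N -> trunc_log 2 (2 ^ x + 2 ^ y) = y.
  move=> xy; apply: trunc_log_eq => //.
  by rewrite leq_addl /= expnS mul2n -addnn ltn_add2r ltn_exp2l.
move=> ab cd e; have bd : b = d by rewrite -(top _ _ ab) e top.
split=> //; move: e; rewrite bd => /addIn /eqP.
by rewrite eqn_exp2l // => /eqP.
Qed.

(* Every graph has a representation: place the vertices at the points
   (2^i, 4^i) of a parabola. The chord slopes 2^i + 2^j are then pairwise
   distinct, so the slopes of the edges are not attained by non-edges. *)
Let pt (v : G) : R * R :=
  let x := 2 ^+ (enum_rank v) in (x, x ^+ 2).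

Let rank_inj : injective (fun v : G => nat_of_ord (enum_rank v)).
Proof. by move=> v w /ord_inj /enum_rank_inj. Qed.

Let pt1_inj v w : (pt v).1 = (pt w).1 -> v = w.
Proof.
move=> /= /eqP; rewrite -!natrX eqr_nat eqn_exp2l // => /eqP.
exact: rank_inj.
Qed.

Let pt_slope v w : v != w ->
  slope (pt v) (pt w) = Some (2 ^ enum_rank v + 2 ^ enum_rank w)%N%:R.
Proof.
move=> vw; rewrite /slope; case: eqP => [/pt1_inj|/eqP].
  by move=> e; rewrite e eqxx in vw.
rewrite /= => ne; congr Some.
rewrite subr_sqr mulrC mulKf; last by rewrite subr_eq0 eq_sym.
by rewrite natrD !natrX addrC.
Qed.

Let slope_adjE v w v' w' : v != w -> v' != w' ->
  slope (pt v) (pt w) = slope (pt v') (pt w') -> adj v w = adj v' w'.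
Proof.
wlog lt1 : v w / (enum_rank v < enum_rank w)%N.
  move=> H vw v'w'; case: (ltngtP (enum_rank v) (enum_rank w)) => lt.
  - exact: H.
  - by rewrite slopeC adj_sym; apply: H => //; rewrite eq_sym.
  - by rewrite (rank_inj lt) eqxx in vw.
wlog lt2 : v' w' / (enum_rank v' < enum_rank w')%N.
  move=> H vw v'w'; case: (ltngtP (enum_rank v') (enum_rank w')) => lt.
  - exact: H.
  - rewrite (slopeC (pt v')) (adj_sym v'); apply: H => //.
    by rewrite eq_sym.
  - by rewrite (rank_inj lt) eqxx in v'w'.
move=> vw v'w'; rewrite !pt_slope // => -[] /eqP.
rewrite eqr_nat => /eqP e.
by have [/rank_inj-> /rank_inj->] := pow2D_inj lt1 lt2 e.
Qed.

Lemma slope_representable_ex : exists k, slope_representable R G k.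
Proof.
pose P := [fset x in [seq pt v | v : G]]%fset.
pose S := [fset x in
  [seq slope (pt p.1) (pt p.2) | p in [pred p : G * G | adj p.1 p.2]]]%fset.
exists #|` S|, P, S; split=> //.
have ptP v : pt v \in P by rewrite inE /=; apply: image_f.
pose f v : P := [` ptP v].
have f_inj : injective f by move=> v w /(congr1 val) [] /pt1_inj.
exists f.
  apply: inj_card_bij f_inj _.
  rewrite -cardfE card_fseq (leq_trans (size_undup _)) //.
  by rewrite size_map -cardE.
move=> v w; rewrite /= /slope_adj (inj_eq f_inj) /=.
have [->|vw] /= := eqVneq v w; first by rewrite adj_irr.
apply/idP/idP => [|vwE].
  rewrite inE /= => /imageP[[v' w'] /= v'w' /slope_adjE -> //].
  by apply: contraTneq v'w' => ->; rewrite inE /= adj_irr.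
by rewrite inE /=; apply/imageP; exists (v, w).
Qed.

End Existence.

Lemma slope_representable_exb (R : realType) (G : sgraph) :
  exists k, `[< slope_representable R G k >].
Proof. by have [k /asboolP] := slope_representable_ex R G; exists k. Qed.

Definition sl (R : realType) (G : sgraph) : nat :=
  ex_minn (slope_representable_exb R G).

Definition log2 (R : realType) (x : R) : R := ln x / ln 2.

(* Main.v *)
Require Import Defs.
From mathcomp Require Import all_boot all_order all_algebra.
From mathcomp Require Import finmap.
From mathcomp Require Import boolp reals exp.
From mathcomp Require Import zify lra.

(* Label the vertices by [n] points. Whether an edge is present is decided by
   the vanishing of a polynomial in the coordinates and the slopes, so graphs
   with slope parameter at most [k] correspond to zero patterns of these
   'C(n, 2) polynomials. By a linear algebra argument the number of zero
   patterns is at most the dimension of a space containing all the products of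
   distinct polynomials of the family. Bounding the degree in each variable
   separately, only the slopes contribute to the leading term: there are [k] of
   them, each of degree at most 'C(n, 2), which gives the dimension
   n ^ (2 k + O(n)). Comparing with the 2 ^ 'C(n, 2) graphs on [n] labelled
   vertices bounds [k] from below. *)

Set Implicit Arguments.
Unset Strict Implicit.
Unset Printing Implicit Defensive.

Import Order.TTheory GRing.Theory Num.Theory.

Local Open Scope ring_scope.

(** * Polynomial functions with a degree bound in each variable, and their zero patterns *)

Section BoxPolynomials.
Variables (F : fieldType) (T : finType).
Implicit Types (v : T -> F) (d : T -> nat) (f g : (T -> F) -> F).

Definition monomial (e : T -> nat) v : F := \prod_t v t ^+ e t.

(* Polynomial functions of degree at most [d t] in each variable [t]. *)
Definition box_poly d g :=
  exists2 s : seq (F * {ffun T -> nat}),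
    forall p, p \in s -> forall t, (p.2 t <= d t)%N &
    forall v, g v = \sum_(p <- s) p.1 * monomial p.2 v.

Lemma box_poly_le d1 d2 g :
  (forall t, (d1 t <= d2 t)%N) -> box_poly d1 g -> box_poly d2 g.
Proof.
by move=> led [s sd sE]; exists s => // p /sd pd t; apply: leq_trans (led t).
Qed.

Lemma box_poly_cst d a : box_poly d (fun=> a).
Proof.
exists [:: (a, [ffun=> 0%N])] => [p|v].
  by rewrite inE => /eqP -> t; rewrite ffunE.
rewrite big_seq1 /monomial big1 ?mulr1 // => t _.
by rewrite ffunE expr0.
Qed.

Lemma box_poly_var d t : (0 < d t)%N -> box_poly d (fun v => v t).
Proof.
move=> dt; exists [:: (1, [ffun u => (u == t) : nat])] => [p|v].
  rewrite inE => /eqP -> u; rewrite ffunE /=.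
  by case: eqP => // ->.
rewrite big_seq1 /monomial (bigD1 t) //= big1 => [|u /negPf ut].
  by rewrite ffunE eqxx expr1 mul1r mulr1.
by rewrite ffunE ut expr0.
Qed.

Lemma box_polyD d f g :
  box_poly d f -> box_poly d g -> box_poly d (fun v => f v + g v).
Proof.
move=> [s sd sE] [r rd rE]; exists (s ++ r) => [p|v].
  by rewrite mem_cat => /orP[/sd|/rd].
by rewrite big_cat sE rE.
Qed.

Lemma box_polyM d1 d2 f g : box_poly d1 f -> box_poly d2 g ->
  box_poly (fun t => d1 t + d2 t)%N (fun v => f v * g v).
Proof.
move=> [s sd sE] [r rd rE].
pose mul (p q : F * {ffun T -> nat}) : F * {ffun T -> nat} :=
  (p.1 * q.1, [ffun t => (p.2 t + q.2 t)%N]).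
exists [seq mul p q | p <- s, q <- r].
  move=> _ /allpairsP[[p q] [/= /sd ps /rd qr ->]] t.
  by rewrite ffunE leq_add.
move=> v; rewrite big_allpairs_dep sE rE mulr_suml; apply: eq_bigr => p _.
rewrite mulr_sumr; apply: eq_bigr => q _ /=; rewrite mulrACA; congr (_ * _).
by rewrite -big_split; apply: eq_bigr => t _; rewrite ffunE exprD.
Qed.

Lemma box_polyB d f g :
  box_poly d f -> box_poly d g -> box_poly d (fun v => f v - g v).
Proof.
move=> bf bg; have [s sd sE] := box_polyM (box_poly_cst (fun=> 0%N) (-1)) bg.
by apply: box_polyD => //; exists s => // v; rewrite -sE mulN1r.
Qed.

Lemma box_poly_prod (I : finType) (A : pred I) (d : I -> T -> nat)
    (f : I -> (T -> F) -> F) :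
  (forall i, A i -> box_poly (d i) (f i)) ->
  box_poly (fun t => \sum_(i | A i) d i t)%N (fun v => \prod_(i | A i) f i v).
Proof.
move=> bf; elim: (index_enum I) => [|i r IH].
  have [s sd sE] := box_poly_cst (fun=> 0%N) 1.
  exists s => [p /sd ps t | v]; first by rewrite big_nil.
  by rewrite big_nil -sE.
have [Ai|Ai] := boolP (A i); last first.
  case: IH => s sd sE; exists s => [p /sd ps t | v].
    by rewrite big_cons (negPf Ai).
  by rewrite big_cons (negPf Ai).
have [s sd sE] := box_polyM (bf i Ai) IH.
exists s => [p /sd ps t | v]; first by rewrite big_cons Ai.
by rewrite big_cons Ai.
Qed.

(** Merging terms with equal exponents gives coefficients indexed by a fixed finite set, whose size
    is the dimension used for counting. *)
Lemma box_poly_span d g : box_poly d g ->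
  exists c : {dffun forall t, 'I_(d t).+1} -> F,
    forall v, g v = \sum_e c e * monomial (fun t => e t) v.
Proof.
move=> [s sd sE].
pose code (p : F * {ffun T -> nat}) : {dffun forall t, 'I_(d t).+1} :=
  [ffun t => inord (p.2 t)].
exists (fun e => \sum_(p <- s | code p == e) p.1) => v.
rewrite sE (partition_big code xpredT) //=; apply: eq_bigr => e _.
rewrite mulr_suml [LHS]big_seq_cond [RHS]big_seq_cond.
apply: eq_bigr => p /andP[/sd pd /eqP <-]; congr (_ * _).
by apply: eq_bigr => t _; rewrite ffunE inordK // ltnS.
Qed.

(* Rónyai, Babai and Ganapathy: for the pattern [w] put [g w] the product of
   the [f e] over [e] in [w]. Then [g w] does not vanish at the witness of
   [w'] iff [w] is a subset of [w'], so the matrix of these values is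
   triangular and the [g w] are linearly independent. *)
Lemma zero_patterns_le (E : finType) (f : E -> (T -> F) -> F) (d : T -> nat)
    (W : finType) (u : W -> T -> F) :
  (forall e, box_poly d (f e)) ->
  injective (fun w => [set e | f e (u w) != 0]) ->
  (#|W| <= \prod_t (#|E| * d t).+1)%N.
Proof.
move=> fd pat_inj; pose pat w := [set e | f e (u w) != 0].
pose D t := (#|E| * d t)%N.
have gd w : box_poly D (fun v => \prod_(e in pat w) f e v).
  apply: (@box_poly_le (fun t => \sum_(e in pat w) d t)%N) => [t|].
    by rewrite sum_nat_const leq_mul2r max_card orbT.
  exact: box_poly_prod.
have [c cE] := choice (fun w => box_poly_span (gd w)).
pose U := {dffun forall t, 'I_(D t).+1}.
have <- : #|{: U}| = (\prod_t (#|E| * d t).+1)%N.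
  rewrite card_dep_ffun /= /image_mem foldrE big_map big_enum.
  by apply: eq_bigr => t _; rewrite card_ord.
pose g w w' := \prod_(e in pat w) f e (u w').
have g_neq0 w w' : (g w w' != 0) = (pat w \subset pat w').
  apply/prodf_neq0/subsetP => H e /H; first by rewrite inE.
  by rewrite inE.
(* The matrix of the values [g] factors through the monomials, so its rank is at most [#|{: U}|]. *)
pose B := \matrix_(i < #|W|, j < #|{: U}|) c (enum_val i) (enum_val j).
pose C := \matrix_(j < #|{: U}|, i < #|W|)
  monomial (fun t => (enum_val j : U) t) (u (enum_val i)).
have BC i j : (B *m C) i j = g (enum_val i) (enum_val j).
  rewrite mxE /g cE (reindex (@enum_val U predT)) /=; last first.
    by apply: onW_bij; apply: enum_val_bij.
  by apply: eq_bigr => k _; rewrite !mxE.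
suff /eqP <- : row_free (B *m C) by apply: mulmx_max_rank.
rewrite -kermx_eq0; apply/rowV0P => x /sub_kermxP xBC.
apply: contraTeq isT => x_neq0.
have [i0 xi0] : exists i, x 0 i != 0.
  by apply/existsP; apply: contraNT x_neq0 => /existsPn x0;
    apply/eqP/rowP => i; rewrite mxE; apply/eqP; rewrite -[_ == _]negbK x0.
(* In column [i], another nonzero term would need a pattern contained in that of [i]; minimal size
   makes the two equal, against injectivity. *)
have [i xi imin] := @arg_minnP _ i0 (fun i => x 0 i != 0)
  (fun i => #|pat (enum_val i)|) xi0.
have /rowP/(_ i) := xBC; rewrite !mxE (bigD1 i) //= big1 => [|j ji].
  rewrite addr0 BC => /eqP; rewrite mulf_eq0 (negPf xi) /=.
  by rewrite -[_ == _]negbK g_neq0 subxx.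
have [->|xj] := eqVneq (x 0 j) 0; first by rewrite mul0r.
rewrite BC; apply/eqP; rewrite mulf_eq0 (negPf xj) -[_ == _]negbK g_neq0.
apply: contra ji => sub.
apply/eqP/enum_val_inj/pat_inj/eqP.
by rewrite -/(pat _) -/(pat _) eqEcard sub imin.
Qed.

End BoxPolynomials.

Lemma prod_option_sum (I J : finType) (a : nat) (F : option I + J -> nat) b :
  (forall i, F (inl i) = a) -> (forall j, F (inr j) = b) ->
  (\prod_t F t = a ^ #|I|.+1 * b ^ #|J|)%N.
Proof.
move=> Fa Fb; rewrite big_sumType /=.
under eq_bigr do rewrite Fa; under [X in (_ * X)%N]eq_bigr do rewrite Fb.
by rewrite !prod_nat_const card_option.
Qed.

(** * Labelled graphs as sets of edges *)

Section GraphsOnOrdinals.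
Variable n : nat.

Definition edge := {p : 'I_n * 'I_n | (p.1 < p.2)%N}.

(** Each [j] is the larger endpoint of exactly [j] edges. *)
Lemma card_edge : #|{: edge}| = 'C(n, 2).
Proof.
rewrite card_sig -sum1_card -bin2_sum big_mkord.
transitivity (\sum_(j < n) \sum_(i < n | (i < j)%N) 1)%N.
  by rewrite (exchange_big_dep xpredT) //= pair_big_dep.
apply: eq_bigr => j _; rewrite (big_ord_narrow (ltnW (ltn_ord j))).
by rewrite sum1_card card_ord.
Qed.

Definition edge_adj (w : {set edge}) : rel 'I_n := fun i j =>
  [exists e in w, (val e == (i, j)) || (val e == (j, i))].

Lemma edge_adj_sym w : symmetric (edge_adj w).
Proof. by move=> i j; apply: eq_existsb => e; rewrite orbC. Qed.

Lemma edge_adj_irr w : irreflexive (edge_adj w).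
Proof.
move=> i; apply/existsP => -[[e lt_e]] /andP[_].
by rewrite orbb => /eqP /= ee; rewrite ee ltnn in lt_e.
Qed.

Definition edge_graph w : sgraph :=
  SGraph (@edge_adj_sym w) (@edge_adj_irr w).

Lemma edge_adjE w (e : edge) : edge_adj w (val e).1 (val e).2 = (e \in w).
Proof.
apply/existsP/idP => [[e' /andP[we' /orP[]]]|we].
- by rewrite -surjective_pairing => /eqP/val_inj <-.
- move=> /eqP ee'; have := valP e'; rewrite ee' /= => lt.
  by have := ltn_trans lt (valP e); rewrite ltnn.
- by exists e; rewrite we -surjective_pairing eqxx.
Qed.

End GraphsOnOrdinals.

Lemma fresh_real (R : realType) (s : seq R) : exists a, a \notin s.
Proof.
exists (1 + \sum_(x <- s) `|x|); apply/negP => sin.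
suff : 1 + \sum_(x <- s) `|x| <= \sum_(x <- s) `|x|.
  by rewrite -subr_ge0 opprD addrCA subrr addr0 oppr_ge0 ler10.
rewrite {2}(big_rem _ sin) /= (le_trans (ler_norm _)) // lerDl.
by apply: sumr_ge0.
Qed.

(** * Polynomials that detect edges *)

Section SlopePolynomials.
Variables (R : realType) (n k : nat).

(* The variables are an indicator [c] (0 if vertical edges are allowed, 1
   otherwise), the [k] finite slopes, and the coordinates of the [n] points. *)
Definition slope_var : finType := (option 'I_k + bool * 'I_n)%type.

Definition vert (v : slope_var -> R) := v (inl None).
Definition slp v l : R := v (inl (Some l) : slope_var).
Definition xcoord v i : R := v (inr (false, i) : slope_var).
Definition ycoord v i : R := v (inr (true, i) : slope_var).

(* At a witness, it vanishes iff the slope of the edge is one of the allowed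
   slopes. *)
Definition edge_poly (e : edge n) v : R :=
  let i := (val e).1 in let j := (val e).2 in
  (vert v + (1 - vert v) * (xcoord v j - xcoord v i)) *
  \prod_(l < k) (ycoord v j - ycoord v i -
                 slp v l * (xcoord v j - xcoord v i)).

(** Each slope occurs in only one factor of [edge_poly], hence degree 1; a coordinate can occur in
    all [k.+1] factors. *)
Definition edge_deg (t : slope_var) : nat := if t is inl _ then 1 else k.+1.

Lemma box_edge_poly e : box_poly edge_deg (edge_poly e).
Proof.
pose isc (t : slope_var) : nat := if t is inl None then 1 else 0.
pose isl l (t : slope_var) : nat := if t is inl (Some l') then l == l' else 0.
pose iscoord (t : slope_var) : nat := if t is inr _ then 1 else 0.
pose d0 t := (isc t + iscoord t)%N.
pose d1 l t := (isl l t + iscoord t)%N.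
apply: (@box_poly_le _ _ (fun t => d0 t + \sum_(l < k) d1 l t)%N).
  have sum1 : (\sum_(l < k) 1 = k)%N by rewrite sum1_card card_ord.
  rewrite /d0 /d1 => -[[l|]|p] /=.
  - rewrite (bigD1 l) //= eqxx big1 // => l' /negPf ->.
    by [].
  - by rewrite big1.
  - by rewrite sum1.
apply: (@box_polyM _ _ d0); last apply: box_poly_prod => l _.
  apply: box_polyD; first exact: box_poly_var.
  apply: box_polyM; last by apply: box_polyB; apply: box_poly_var.
  by apply: box_polyB; [apply: box_poly_cst | apply: box_poly_var].
apply: box_polyB.
  by apply: box_polyB; apply: box_poly_var; rewrite /d1 addn1.
apply: box_polyM; first by apply: box_poly_var; rewrite /= eqxx.
by apply: box_polyB; apply: box_poly_var.
Qed.

Lemma edge_poly_witness (w : {set edge n}) k' : (k' <= k)%N ->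
  slope_representable R (edge_graph w) k' ->
  exists v, forall e, (edge_poly e v == 0) = (e \in w).
Proof.
move=> lek [P [S [cardS [f f_bij f_adj]]]].
pose p i := val (f i); have p_inj : injective p.
  by move=> i j /val_inj /(bij_inj f_bij).
pose s := pmap id S.
have sS a : (a \in s) = (Some a \in S) by rewrite mem_pmap map_id.
(* There may be fewer than [k] finite slopes; the spare variables get a value [a] that is the slope
   of no two points, so they add no zeros. *)
have [a aP] := fresh_real (pmap id
  ([seq slope (p e.1) (p e.2) | e : 'I_n * 'I_n] ++ S)).
have size_s : (size s <= k)%N.
  by rewrite size_pmap (leq_trans (count_size _ _)) // cardS.
exists (fun t : slope_var => match t with
  | inl None => (None \notin S)%:R
  | inl (Some l) => nth a s l
  | inr (b, i) => if b then (p i).2 else (p i).1 end) => e.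
rewrite -edge_adjE -[edge_adj _ _ _]/(@adj (edge_graph w) _ _) -f_adj.
rewrite /= /slope_adj (inj_eq (bij_inj f_bij)).
have ij : (val e).1 != (val e).2.
  by apply: contraTneq (valP e) => ->; rewrite ltnn.
rewrite ij /edge_poly /vert /slp /xcoord /ycoord.
move: (val e).1 (val e).2 ij => i j ij /=.
rewrite -/(p i) -/(p j) mulf_eq0.
have slope_a : slope (p i) (p j) != Some a.
  apply: contra aP => /eqP ija; rewrite mem_pmap map_id mem_cat -ija.
  by rewrite (image_f (fun e => slope (p e.1) (p e.2)) (x := (i, j))).
move: slope_a; rewrite /slope.
(* On a vertical line each factor of the product is the nonzero difference of ordinates, so the
   first factor decides; otherwise the first factor is nonzero and the product decides. *)
have [pij|pij] := eqVneq (p i).1 (p j).1 => slope_a.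
  have yij : (p j).2 - (p i).2 != 0.
    rewrite subr_eq0; apply: contra ij => /eqP yij.
    by apply/eqP/p_inj/eqP; rewrite -pair_eqE /pair_eq /= pij yij !eqxx.
  rewrite pij subrr mulr0 addr0 pnatr_eq0 eqb0 negbK.
  rewrite [X in _ || X](_ : _ = false) ?orbF //; apply/negbTE/prodf_neq0.
  by move=> l _; rewrite mulr0 subr0.
have xij : (p j).1 - (p i).1 != 0 by rewrite subr_eq0 eq_sym.
rewrite [X in X || _](_ : _ = false) /=; last first.
  by case: (None \in S) => /=; apply/negbTE;
    rewrite ?subrr ?mul0r ?addr0 ?oner_neq0 // add0r subr0 mul1r.
rewrite -sS; apply/prodf_eq0/idP => [[l _]|sl].
  rewrite subr_eq0 => /eqP e_l; move: slope_a.
  rewrite e_l mulfK // => sl; apply: mem_nth.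
  by rewrite ltnNge; apply: contra sl => /(nth_default _) ->.
have lt_s := sl; rewrite -index_mem in lt_s.
exists (Ordinal (leq_trans lt_s size_s)) => //=.
by rewrite nth_index // divfK // subrr.
Qed.
End SlopePolynomials.

(** * Counting and asymptotics *)

Lemma pow2_bin2_le (R : realType) (n k : nat) :
  (forall w : {set edge n}, (sl R (edge_graph w) <= k)%N) ->
  (2 ^ 'C(n, 2) <= 'C(n, 2).+1 ^ k.+1 * ('C(n, 2) * k.+1).+1 ^ n.*2)%N.
Proof.
move=> sl_le.
have wit (w : {set edge n}) : exists v : slope_var n k -> R,
    forall e, (edge_poly e v == 0) = (e \in w).
  apply: (edge_poly_witness (sl_le w)); rewrite /sl.
  by case: ex_minnP => m /asboolP.
have [u uP] := choice wit.
(* The nonvanishing set at [u w] is the complement of [w], so distinct edge sets give distinct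
   patterns. *)
have := @zero_patterns_le _ _ _ (@edge_poly R n k) _ _ u (@box_edge_poly R n k).
rewrite -cardsT -powersetT card_powerset cardsT card_edge.
rewrite (@prod_option_sum _ _ 'C(n, 2).+1 _ ('C(n, 2) * k.+1).+1) /=; last 2 first.
- by move=> i; rewrite muln1.
- by [].
rewrite card_ord card_prod card_bool card_ord mul2n; apply.
move=> w w' /setP e; apply/setP => x; rewrite -!uP; have := e x.
by rewrite !inE; apply: contra_eq; do 2!case: (_ == 0).
Qed.

(** With [r] the square root of [n], [ln n = 2 ln r <= 2 r], and [2 r <= d * ln 2 * r ^ 2] once [r]
    is at least [A]. *)
Lemma log2_sublinear (R : realType) (d : R) : 0 < d ->
  exists N : nat, forall n : nat, (N < n)%N -> log2 (n%:R : R) <= d * n%:R.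
Proof.
move=> d_gt0; have ln2 : 0 < ln 2 :> R by apply: ln_gt0; rewrite ltr1n.
pose A : R := 2 / (d * ln 2); have A_gt0 : 0 < A by rewrite divr_gt0 ?mulr_gt0.
exists (Num.bound (A ^+ 2)) => n ltn.
have n_gt0 : 0 < n%:R :> R by rewrite ltr0n (leq_ltn_trans _ ltn).
pose r : R := Num.sqrt n%:R; have r_gt0 : 0 < r by rewrite sqrtr_gt0.
have nE : n%:R = r ^+ 2 by rewrite sqr_sqrtr // ltW.
have ltA : A ^+ 2 < r ^+ 2.
  rewrite -nE (lt_trans (archi_boundP _)) ?ltr_nat //.
  by rewrite exprn_ge0 // ltW.
have leA : A <= r by rewrite leNgt; apply: contraTN ltA => /ltW rA;
  rewrite -leNgt ler_pXn2r // nnegrE ltW.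
rewrite /log2 ler_pdivrMr // nE lnXn // (le_trans (_ : _ <= r *+ 2)) //.
  by rewrite lerMn2r (ltW (ln_sublinear _)).
move: leA; rewrite /A ler_pdivrMr ?mulr_gt0 // => leA.
have := ler_wpM2r (ltW r_gt0) leA; rewrite -mulr_natl expr2; lra.
Qed.

(** The two bases are at most [n ^ 2] and [n ^ 4]; taking logarithms and doubling gives the factor
    4. *)
Lemma bin2_le_log2 (R : realType) (n k : nat) : (1 < n)%N ->
  (k.+1 <= n ^ 2)%N ->
  (2 ^ 'C(n, 2) <= 'C(n, 2).+1 ^ k.+1 * ('C(n, 2) * k.+1).+1 ^ n.*2)%N ->
  n%:R * (n%:R - 1) <= 4 * (k%:R + 1 + 4 * n%:R) * log2 (n%:R : R).
Proof.
move=> n_gt1 lek le2.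
have ln2 : 0 < ln 2 :> R by apply: ln_gt0; rewrite ltr1n.
have Ele : ('C(n, 2).+1 <= n ^ 2)%N by rewrite bin2 -divn2; nia.
have Mle : (('C(n, 2) * k.+1).+1 <= n ^ 4)%N.
  rewrite (expnD n 2 2) (leq_trans _ (leq_mul Ele lek)) //.
  by rewrite mulSn addSn ltnS leq_addl.
have {le2} : (2 ^ 'C(n, 2) <= n ^ (2 * k.+1 + 4 * n.*2))%N.
  by rewrite (leq_trans le2) // expnD !expnM leq_mul ?leq_exp2r ?double_gt0 //;
    case: (n) n_gt1.
rewrite -(ler_nat R) !natrX -ler_ln ?posrE ?exprn_gt0 ?ltr0n //; last first.
  by rewrite (ltn_trans _ n_gt1).
rewrite !lnXn ?ltr0n //; last by rewrite (ltn_trans _ n_gt1).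
rewrite -[ln 2 *+ _]mulr_natl -[ln n%:R *+ _]mulr_natl => le2.
have binE : n%:R * (n%:R - 1) = 2 * 'C(n, 2)%:R :> R.
  rewrite -natrM mul2n bin2 halfK (_ : odd _ = false) ?subn0; last first.
    by rewrite oddM; case: (n) n_gt1 => //= m _; case: (odd m).
  by rewrite natrM -[in RHS]subn1 natrB // ltnW.
rewrite binE /log2 mulrA ler_pdivlMr //.
have -> : 4 * (k%:R + 1 + 4 * n%:R) = 2 * (2 * k.+1 + 4 * n.*2)%:R :> R.
  rewrite natrD !natrM -mul2n natrM -natr1; lra.
by rewrite -!(mulrA 2) ler_pM2l.
Qed.

Theorem theorem4 (R : realType) (eps : R) (heps : 0 < eps) :
  exists N : nat, forall n : nat, (N < n)%N ->
    exists G : sgraph, #|G| = n /\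
      (sl R G)%:R >= n%:R ^+ 2 / ((4 + eps) * log2 n%:R).
Proof.
(* Here 21 = 1 + 4 + 16 collects the lower-order terms [n], [4 log n] and [16 n log n], each bounded
   by a multiple of [n log n]. *)
pose d : R := eps / (21 * (4 + eps)).
have d_gt0 : 0 < d by rewrite divr_gt0 // mulr_gt0 ?ltr0n // addr_gt0.
have [N NP] := log2_sublinear d_gt0.
exists (maxn N 1) => n; rewrite gtn_max => /andP[/NP le_d n_gt1].
pose w := [arg max_(w > set0 : {set edge n}) sl R (edge_graph w)].
exists (edge_graph w); split; first exact: card_ord.
have : forall w' : {set edge n}, (sl R (edge_graph w') <= sl R (edge_graph w))%N.
  by rewrite /w; case: arg_maxnP => // w0 _ w0P w'; apply: w0P.
move: (sl R (edge_graph w)) => k /pow2_bin2_le le2.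
have ln2 : 0 < ln 2 :> R by apply: ln_gt0; rewrite ltr1n.
have n_gt0 : 0 < n%:R :> R by rewrite ltr0n ltnW.
have log_ge1 : 1 <= log2 (n%:R : R).
  by rewrite /log2 ler_pdivlMr // mul1r ler_ln ?posrE ?ltr0n ?ler_nat // ltnW.
rewrite ler_pdivrMr; last by rewrite mulr_gt0 ?addr_gt0 // (lt_le_trans ltr01).
(* If [k >= n ^ 2], the claim follows from [(4 + eps) * log2 n >= 1]. *)
have [lek|ltk] := leqP k.+1 (n ^ 2)%N; last first.
  rewrite -natrX (le_trans (_ : _ <= k%:R)) ?ler_nat // ler_peMr //; nra.
have := bin2_le_log2 R n_gt1 lek le2.
have n_ge1 : 1 <= n%:R :> R by rewrite ler1n ltnW.
have {le_d} : 21 * ((4 + eps) * log2 (n%:R : R)) <= eps * n%:R.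
  have dE : 21 * (4 + eps) * d = eps by rewrite /d mulrC divfK //; lra.
  rewrite mulrA -[in leRHS]dE -[leRHS]mulrA ler_wpM2l //.
  by rewrite mulr_ge0 // addr_ge0 // ltW.
set l := log2 _ in log_ge1 *; set x := n%:R in n_ge1 *; set y := k%:R.
move=> l_small le_y.
have {le_y} : x ^+ 2 - 21 * (x * l) <= 4 * (l * y) by nra.
have eps4_ge0 : 0 <= 4 + eps by lra.
move=> /(ler_wpM2l eps4_ge0) le_y.
(* The error [21 (4 + eps) x l] is at most [eps x ^ 2], which leaves [4 x ^ 2] of
   [(4 + eps) x ^ 2]. *)
have := ler_wpM2l (le_trans ler01 n_ge1) l_small.
nra.
Qed.
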